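(* Let $(G,K)$ be a Gelfand pair. Every right $K$-invariant restricted convolution semigroup $(\mu_t, t\ge 0)$ on $G$ is a continuous $K$-bi-invariant convolution semigroup.
   Context: A Gelfand pair $(G,K)$ consists of a locally compact Hausdorff group $G$ with neutral element $e$ and a compact subgroup $K$ such that the Banach algebra $L^1(K\backslash G/K)$ of $K$-bi-invariant integrable functions on $G$ is commutative under convolution. $C_u(G)$ is the space of real-valued bounded functions $f$ on $G$ that are uniformly continuous in the sense that for every $\epsilon>0$ there is a neighbourhood $U$ of $e$ with $\sup_{x\in G}|f(g^{-1}x)-f(x)|<\epsilon$ for all $g\in U$. $C_c(G)$ is the subspace of functions with compact support. $C_u(G/K)$ and $C_c(G/K)$ denote the subspaces of right $K$-invariant functions in $C_u(G)$ and $C_c(G)$ respectively (identified with functions on the space $G/K$ of left cosets). A measure $\mu$ on the Borel $\sigma$-algebra $\mathcal B(G)$ is right $K$-invariant if $\mu(Ak)=\mu(A)$ for all $A\in\mathcal B(G)$, $k\in K$; it is $K$-bi-invariant if also $\mu(kA)=\mu(A)$ for all such $A,k$. The convolution $\mu_1*\mu_2$ of finite measures is defined by $\int_G f\,d(\mu_1*\mu_2)=\int_G\int_G f(gh)\mu_1(dg)\mu_2(dh)$ for $f\in C_c(G)$. A family $(\mu_t,t\ge0)$ of probability measures on $(G,\mathcal B(G))$ is a convolution semigroup if $\mu_{s+t}=\mu_s*\mu_t$ for all $s,t\ge 0$; it is continuous if $\mu_t\to\mu_0$ vaguely as $t\to 0$; it is $K$-bi-invariant if each $\mu_t$ is $K$-bi-invariant.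 A family $(\mu_t,t\ge 0)$ of probability measures on $(G,\mathcal B(G))$ is a right $K$-invariant restricted convolution semigroup if: (A1) $\mu_t$ is right $K$-invariant for all $t>0$; (A2) $\mu_0=\delta_e$, the Dirac measure at $e$; (A3) $\int_G f(g)\mu_{s+t}(dg)=\int_G\int_G f(gh)\mu_s(dg)\mu_t(dh)$ for all $f\in C_u(G/K)$ and all $s,t\ge 0$; (A4) $\lim_{t\to0}\int_G f(g)\mu_t(dg)=f(e)$ for all $f\in C_c(G/K)$.
   Formalization: Measures are Radon. As δ_e is not K-bi-invariant unless K={e}, the claim fails at t=0; proved: (μ_t) is a convolution semigroup, K-bi-invariant for t>0, and with μ_0 replaced by the normalised Haar measure of K it is a continuous K-bi-invariant convolution semigroup. *)

(* Defs.v *)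
From HB Require Import structures.
From mathcomp Require Import all_boot all_order all_algebra.
From mathcomp Require Import all_classical all_reals all_analysis.

Set Implicit Arguments.
Unset Strict Implicit.
Unset Printing Implicit Defensive.

Import Order.TTheory GRing.Theory Num.Theory.
Import numFieldNormedType.Exports.

Local Open Scope classical_set_scope.
Local Open Scope ring_scope.

(* The base point of [PointedTopological] is only there because
   [g_sigma_algebraType] requires a pointed type; it plays no role below and
   need not be the neutral element. *)
HB.mixin Record isTopologicalGroup G of PointedTopological G & Group G := {
  mulg_continuous : continuous (fun x : G * G => (x.1 * x.2)%g) ;
  invg_continuous : continuous (fun x : G => (x^-1)%g)
}.

#[short(type="topologicalGroupType")]
HB.structure Definition TopologicalGroup :=
  {G of isTopologicalGroup G & PointedTopological G & Group G}.

Notation borel G := (g_sigma_algebraType (@open G)).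

Section Defs.
Variables (R : realType) (G : topologicalGroupType).
Implicit Types (K A C U : set G) (f : G -> R).
Implicit Types mu nu : {measure set (borel G) -> \bar R}.

(* The argument is typed [G -> R], and not [borel G -> R], so that the group
   law can be used in integrands. *)
Definition integ mu f : R := \int[mu]_x f x.

(* Radon measures, in the form used for Haar measures: finite on compact sets,
   outer regular, and inner regular on open sets. *)
Record radon mu : Prop := Radon {
  radon_compact : forall C, compact C -> (mu C < +oo)%E ;
  radon_outer : forall A, measurable (A : set (borel G)) ->
    mu A = ereal_inf [set mu U | U in [set U | open U /\ A `<=` U]] ;
  radon_inner : forall U, open U ->
    mu U = ereal_sup [set mu C | C in [set C | compact C /\ C `<=` U]]
}.

Definition left_invariant K mu := forall A k,
  measurable (A : set (borel G)) -> K k ->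
  mu [set (k * a)%g | a in A] = mu A.

Definition right_invariant K mu := forall A k,
  measurable (A : set (borel G)) -> K k ->
  mu [set (a * k)%g | a in A] = mu A.

Definition bi_invariant K mu := right_invariant K mu /\ left_invariant K mu.

Record left_haar mu : Prop := LeftHaar {
  left_haar_radon : radon mu ;
  left_haar_neq0 : mu setT != 0%E ;
  left_haar_invariant : left_invariant setT mu
}.

Record compact_subgroup K : Prop := CompactSubgroup {
  subgroup_one : K 1%g ;
  subgroup_mul : forall x y, K x -> K y -> K (x * y)%g ;
  subgroup_inv : forall x, K x -> K (x^-1)%g ;
  subgroup_compact : compact K
}.

(* The normalised Haar measure of [K], regarded as a measure on [G]. *)
Record normalized_haar_of K (omega : probability (borel G) R) : Prop :=
  NormalizedHaar {
    normalized_haar_radon : radon omega ;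
    normalized_haar_supp : omega K = 1%E ;
    normalized_haar_invariant : left_invariant K omega
  }.

Definition convolution mu f1 f2 : G -> R :=
  fun x => integ mu (fun y => f1 y * f2 (y^-1 * x)%g).

(* Representatives of the elements of L^1(K\G/K). *)
Definition L1_bi_invariant mu K f :=
  mu.-integrable setT (EFin \o f : borel G -> \bar R) /\
  forall k1 k2 x, K k1 -> K k2 -> f (k1 * x * k2)%g = f x.

(* Haar measures being unique up to a positive factor, the choice of [m] is
   immaterial. *)
Record gelfand_pair K : Prop := GelfandPair {
  gelfand_locally_compact : locally_compact [set: G] ;
  gelfand_hausdorff : hausdorff_space G ;
  gelfand_compact_subgroup : compact_subgroup K ;
  gelfand_commutative :
    exists2 m : {measure set (borel G) -> \bar R}, left_haar m &
      forall f1 f2, L1_bi_invariant m K f1 -> L1_bi_invariant m K f2 ->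
        {ae m, forall x, convolution m f1 f2 x = convolution m f2 f1 x}
}.

Record Cu f : Prop := MkCu {
  Cu_bounded : exists M : R, forall x, `|f x| <= M ;
  Cu_unif : forall eps : R, 0 < eps ->
    exists2 U, nbhs (1%g : G) U & forall g, U g ->
      sup (range (fun x => `|f (g^-1 * x)%g - f x|)) < eps
}.

Definition Cc f := Cu f /\ compact (closure [set x | f x != 0]).

Definition right_invariant_fun K f :=
  forall x k, K k -> f (x * k)%g = f x.

(* [is_convolution mu1 mu2 nu]: nu = mu1 * mu2. This determines [nu] among the
   Radon measures. *)
Definition is_convolution mu1 mu2 nu := forall f, Cc f ->
  integ nu f = integ mu2 (fun h => integ mu1 (fun g => f (g * h)%g)).

(* Families of measures are indexed by [R]; only the indices [t >= 0] matter. *)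
Implicit Types mut : R -> probability (borel G) R.

Record convolution_semigroup mut : Prop := ConvolutionSemigroup {
  convolution_semigroup_radon : forall t, 0 <= t -> radon (mut t) ;
  convolution_semigroup_law : forall s t, 0 <= s -> 0 <= t ->
    is_convolution (mut s) (mut t) (mut (s + t))
}.

Definition vaguely_continuous mut := forall f, Cc f ->
  integ (mut t) f @[t --> 0^'+] --> integ (mut 0) f.

Record continuous_bi_invariant_convolution_semigroup K mut : Prop := {
  cbcs_semigroup : convolution_semigroup mut ;
  cbcs_continuous : vaguely_continuous mut ;
  cbcs_bi_invariant : forall t, 0 <= t -> bi_invariant K (mut t)
}.

Record restricted_convolution_semigroup K mut : Prop := {
  rcs_radon : forall t, 0 <= t -> radon (mut t) ;
  rcs_right_invariant : forall t, 0 < t -> right_invariant K (mut t) ;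
  rcs_zero : forall A, measurable (A : set (borel G)) ->
    mut 0 A = \d_(1%g : borel G) A ;
  rcs_law : forall f s t, Cu f -> right_invariant_fun K f ->
    0 <= s -> 0 <= t ->
    integ (mut (s + t)) f =
      integ (mut t) (fun h => integ (mut s) (fun g => f (g * h)%g)) ;
  rcs_continuous : forall f, Cc f -> right_invariant_fun K f ->
    integ (mut t) f @[t --> 0^'+] --> f 1%g
}.

(* A restricted convolution semigroup starts at the Dirac measure at the neutral
   element, which is not [K]-bi-invariant unless [K] is trivial; as a
   [K]-bi-invariant convolution semigroup the same family starts at the
   normalised Haar measure of [K]. The two initial measures have the same image
   on G/K. *)
Definition replace_at0 (omega : probability (borel G) R) mut :
    R -> probability (borel G) R :=
  fun t => if t == 0 then omega else mut t.

End Defs.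

(* Main.v *)
Require Import Defs.
From mathcomp Require Import all_boot all_order all_algebra.
From mathcomp Require Import all_classical all_reals all_analysis.
From mathcomp Require Import measurable_realfun lra.

(** Write [mu_t] for the given family and [f(. h)] for the function
    [g |-> f (g * h)]. The law [rcs_law] is known only for right [K]-invariant
    integrands, and the point is to remove this restriction and to obtain left
    invariance. Both follow from one observation: for small [s > 0] the measure
    [mu_s] is an approximate Haar measure of [K]. Indeed it is right
    [K]-invariant, and by [rcs_continuous], applied to a right [K]-invariant bump function
    at [K], it carries almost all its mass in [U K] for any prescribed
    neighbourhood [U] of the neutral element ([concentration]).

    Semigroup law. For any bounded uniformly continuous [f] the function
    [x |-> int f (x y^-1) mu_r(dy)] is exactly right [K]-invariant, because
    [f (x k y^-1) = f (x (y k^-1)^-1)] and [mu_r] is right [K]-invariant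
    ([right_smooth_invariant]). Integrated against a right [K]-invariant measure
    it gives nearly the integral of [f] when [r] is small
    ([right_smooth_approx]): for [y = u k] with [u] near the neutral element,
    [k] is absorbed by the invariance of the measure and [u] by the uniform
    continuity of [f]. Applying [rcs_law] to this function and letting [r] tend to 0
    gives the convolution law for all [f] ([restricted_law]).

    Left invariance. As on a compact group, where the right Haar measure is also
    the left one, [mu_s] and its image under inversion nearly agree when [s] is
    small: both are close to
    [int int f (g x^-1 h) mu_s(dg) mu_s(dx)] ([small_time_inverse]), uniformly in
    [h]. Since the image of [mu_s] under inversion is exactly left
    [K]-invariant, the integrals of [f(. h)] and [f(k . h)] against [mu_s] are nearly equal; the
    law [mu_t = mu_s * mu_(t-s)] carries this to [mu_t], and [s] may tend to 0
    ([restricted_left_invariant]).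

    Initial measure. If [omega] is the normalised Haar measure of [K], then
    [f] and its average [x |-> int f (x y) omega(dy)] have the same integral
    against the right [K]-invariant measures [mu_t], and
    [rcs_continuous] applies to the average; hence [mu_t] tends vaguely to [omega] ([restricted_cvg_haar]). The
    right invariance of [omega] is inherited in the limit.

    The group need not be second countable, so that a continuous function on
    [G * G] need not be measurable for the product sigma-algebra. Iterated
    integrals are therefore exchanged by means of [discretize]: on an
    equicontinuous family, a Radon probability measure is uniformly close to a
    finite combination of point masses. Finally, an invariance verified on
    [Cc] passes to Borel sets by regularity ([radon_invariant]). *)

Set Implicit Arguments.
Unset Strict Implicit.
Unset Printing Implicit Defensive.

Import Order.TTheory GRing.Theory Num.Theory.
Import numFieldNormedType.Exports.

Local Open Scope classical_set_scope.
Local Open Scope ring_scope.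

Lemma eq_dist_le (R : realFieldType) (a b : R) :
  (forall e, 0 < e -> `|a - b| <= e) -> a = b.
Proof.
move=> h; apply/eqP; rewrite -subr_eq0 -normr_le0.
by apply/ler_addgt0Pr => e e0; rewrite add0r; exact: h.
Qed.

(** * Topological groups *)

Section GroupTopology.
Variable G : topologicalGroupType.
Implicit Types (A B C K U V : set G).

Lemma cvg_mulg (T : Type) (F : set_system T) (FF : Filter F) (f g : T -> G)
    a b :
  f @ F --> a -> g @ F --> b -> (fun t => (f t * g t)%g) @ F --> (a * b)%g.
Proof.
move=> fa gb.
exact: (cvg_comp (fun t => (f t, g t)) _ (cvg_pair fa gb)
  (@mulg_continuous G (a, b))).
Qed.

Lemma cvg_invg (T : Type) (F : set_system T) (FF : Filter F) (f : T -> G) a :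
  f @ F --> a -> (fun t => (f t)^-1%g) @ F --> (a^-1)%g.
Proof. by move=> fa; exact: (cvg_comp f _ fa (@invg_continuous G a)). Qed.

Lemma continuous_mulgl a : continuous (fun x : G => (a * x)%g).
Proof. by move=> x; apply: cvg_mulg; [exact: cvg_cst|exact: cvg_id]. Qed.

Lemma continuous_mulgr a : continuous (fun x : G => (x * a)%g).
Proof. by move=> x; apply: cvg_mulg; [exact: cvg_id|exact: cvg_cst]. Qed.

Lemma continuous_mulgV a : continuous (fun x : G => (a * x^-1)%g).
Proof.
by move=> y; apply: cvg_mulg; [exact: cvg_cst|exact: invg_continuous].
Qed.

Lemma continuous_mulVg a : continuous (fun x : G => (x^-1 * a)%g).
Proof.
by move=> y; apply: cvg_mulg; [exact: invg_continuous|exact: cvg_cst].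
Qed.

Lemma nbhs1_invg U : nbhs (1%g : G) U -> nbhs (1%g : G) [set u | U (u^-1)%g].
Proof.
by move=> U1; have := @invg_continuous G 1%g;
  rewrite /continuous_at invg1 => /(_ U U1).
Qed.

Lemma nbhs1_conj K U : compact K -> nbhs (1%g : G) U ->
  nbhs (1%g : G) [set u | forall k, K k -> U (k * u * k^-1)%g].
Proof.
move=> /compact_near_coveringP cK U1.
apply: (cK G (nbhs (1%g : G)) (fun u k => U (k * u * k^-1)%g)) => k Kk.
have h : (fun p : G * G => (p.1 * p.2 * p.1^-1)%g) @ (nbhs k, nbhs (1%g : G))
    --> (k * 1 * k^-1)%g.
  apply: cvg_mulg; first by apply: cvg_mulg; [exact: cvg_fst|exact: cvg_snd].
  by apply: cvg_invg; exact: cvg_fst.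
by apply: h; rewrite mulg1 mulgV.
Qed.

Lemma nbhs1_compact_mul C V : compact C -> open V -> C `<=` V ->
  nbhs (1%g : G) [set u | forall c, C c -> V (u * c)%g].
Proof.
move=> /compact_near_coveringP cC oV CV.
apply: (cC G (nbhs (1%g : G)) (fun u c => V (u * c)%g)) => c Cc.
have h : (fun p : G * G => (p.2 * p.1)%g) @ (nbhs c, nbhs (1%g : G))
    --> (1 * c)%g.
  by apply: cvg_mulg; [exact: cvg_snd|exact: cvg_fst].
apply: h; rewrite mul1g; apply: open_nbhs_nbhs; split => //; exact: CV.
Qed.

Lemma compact_mulg A B : compact A -> compact B ->
  compact [set (p.1 * p.2)%g | p in A `*` B].
Proof.
move=> cA cB; apply: continuous_compact; last exact: compact_setX.
by apply: continuous_subspaceT; exact: mulg_continuous.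
Qed.

Lemma image_preimage_can (p q : G -> G) B : cancel p q -> cancel q p ->
  p @` B = q @^-1` B.
Proof.
move=> pq qp; apply/seteqP; split=> x /=; first by move=> [b Bb <-]; rewrite pq.
by move=> Bx; exists (q x).
Qed.

End GroupTopology.

(** * Uniform continuity *)

Section UniformContinuity.
Variables (R : realType) (G : topologicalGroupType).
Implicit Types (f : G -> R) (C : set G).

Definition bdd f := exists M : R, forall x, `|f x| <= M.

Definition left_ucont f := forall e : R, 0 < e ->
  nbhs (1%g : G) [set u | forall x, `|f (u * x)%g - f x| <= e].

Definition right_ucont f := forall e : R, 0 < e ->
  nbhs (1%g : G) [set u | forall x, `|f (x * u)%g - f x| <= e].

Lemma bdd_gt0 f : bdd f -> exists2 M : R, 0 < M & forall x, `|f x| <= M.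
Proof.
move=> [M hM]; exists (`|M| + 1); first by rewrite ltr_wpDl.
by move=> x; rewrite (le_trans (hM x))// (le_trans (ler_norm M))// lerDl.
Qed.

Lemma left_ucont_continuous f : left_ucont f -> continuous f.
Proof.
move=> uf x; apply/(@cvgrPdist_le _ _ _ (nbhs x)) => e e0.
have h : (fun y => (y * x^-1)%g) @ x --> (1%g : G).
  by rewrite -(mulgV x); exact: continuous_mulgr.
apply: (@filterS _ (nbhs x) _ _ _ _ (h _ (uf e e0))) => y /= /(_ x).
by rewrite mulgVK distrC.
Qed.

Lemma Cu_left_ucont f : Cu f -> left_ucont f.
Proof.
case=> [[M hM] uf] e e0; have [U U1 hU] := uf e e0.
apply: (filterS _ (nbhs1_invg U1)) => u /= Uu x.
rewrite (le_trans _ (ltW (hU _ Uu)))// invgK.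
apply: ub_le_sup; last by exists x.
by exists (M + M) => _ [y _ <-]; rewrite (le_trans (ler_normB _ _))// lerD.
Qed.

Lemma left_ucont_Cu f : bdd f -> left_ucont f -> Cu f.
Proof.
move=> bf uf; split=> // e e0; have e20 : 0 < e / 2 by rewrite divr_gt0.
exists [set u | forall x, `|f (u^-1 * x)%g - f x| <= e / 2].
  exact: (nbhs1_invg (uf _ e20)).
move=> g hg; rewrite (@le_lt_trans _ _ (e / 2))//; last by lra.
apply: ge_sup; first by exists `|f (g^-1 * 1)%g - f 1%g|; exists 1%g.
by move=> _ [y _ <-]; exact: hg.
Qed.

Lemma supp_neq0 f x : f x != 0 -> closure [set x | f x != 0] x.
Proof. by move=> fx; exact: subset_closure. Qed.

(** Stated for an arbitrary operation [act] in order to serve for left and right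
    translations. Compactness makes [u] uniform over the support; a point [x]
    outside it is either moved outside, where both values vanish, or moved
    inside, where [u^-1] takes the moved point back to [x]. *)
Lemma compact_supp_uniform f (act : G * G -> G) (e : R) :
  continuous act -> (forall x, act (1%g, x) = x) ->
  (forall u x, act (u^-1, act (u, x))%g = x) ->
  continuous f -> compact (closure [set x | f x != 0]) -> 0 < e ->
  nbhs (1%g : G) [set u | forall x, `|f (act (u, x)) - f x| <= e].
Proof.
move=> cact act1 actK cf; set S := closure _ => cS e0.
have S0 x : ~ S x -> f x = 0.
  by move=> nS; apply/eqP; apply: contrapT => /negP fx; apply: nS;
    exact: supp_neq0.
have hS : nbhs (1%g : G) [set u | forall x, S x -> `|f (act (u, x)) - f x| <= e].
  move/compact_near_coveringP : cS => cS.
  apply: (cS G (nbhs (1%g : G)) (fun u x => `|f (act (u, x)) - f x| <= e)).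
  move=> x Sx.
  have h : (fun p : G * G => f (act (p.2, p.1)) - f p.1)
      @ (nbhs x, nbhs (1%g : G)) --> f (act (1%g, x)) - f x.
    apply: cvgB; last by apply: cvg_comp; [exact: cvg_fst|exact: cf].
    apply: (cvg_comp (fun p : G * G => act (p.2, p.1)) f); last exact: cf.
    apply: (cvg_comp (fun p : G * G => (p.2, p.1)) act); last exact: cact.
    by apply: cvg_pair; [exact: cvg_snd|exact: cvg_fst].
  move: h; rewrite act1 subrr => /cvgrPdist_le /(_ _ e0).
  by apply: filterS => -[a b] /=; rewrite sub0r normrN.
apply: filterS2 hS (nbhs1_invg hS) => u h1 h2 x.
have [Sx|nSx] := pselect (S x); first exact: h1.
have [Sux|nSux] := pselect (S (act (u, x))).
  by rewrite distrC -{1}(actK u x); exact: h2.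
by rewrite !S0// subrr normr0 ltW.
Qed.

Lemma compact_supp_bdd f : continuous f ->
  compact (closure [set x | f x != 0]) -> bdd f.
Proof.
move=> cf; set S := closure _ => cS.
have /compact_bounded [M [_ hM]] : compact (f @` S).
  by apply: continuous_compact => //; exact: continuous_subspaceT.
exists (`|M| + 1) => x; have [Sx|nSx] := pselect (S x).
  by apply: hM; [rewrite ltr_pwDr// ler_norm|exists x].
rewrite (_ : f x = 0) ?normr0 ?addr_ge0//.
by apply/eqP; apply: contrapT => /negP fx; apply: nSx; exact: supp_neq0.
Qed.

Lemma compact_supp_Cc f : continuous f ->
  compact (closure [set x | f x != 0]) -> Cc f.
Proof.
move=> cf cS; split=> //; apply: left_ucont_Cu; first exact: compact_supp_bdd.
move=> e; apply: (compact_supp_uniform (act := fun p => (p.1 * p.2)%g)) => //.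
- exact: mulg_continuous.
- by move=> x /=; rewrite mul1g.
- by move=> u x /=; rewrite mulKg.
Qed.

Lemma Cc_left_ucont f : Cc f -> left_ucont f.
Proof. by case=> /Cu_left_ucont. Qed.

Lemma Cc_bdd f : Cc f -> bdd f.
Proof. by case=> -[]. Qed.

Lemma Cc_continuous f : Cc f -> continuous f.
Proof. by move/Cc_left_ucont/left_ucont_continuous. Qed.

Lemma Cc_right_ucont f : Cc f -> right_ucont f.
Proof.
move=> cf e.
apply: (compact_supp_uniform (act := fun p => (p.2 * p.1)%g)); last by case: cf.
- by move=> p; apply: cvg_mulg; [exact: cvg_snd|exact: cvg_fst].
- by move=> x /=; rewrite mulg1.
- by move=> u x /=; rewrite mulgK.
- exact: Cc_continuous.
Qed.

Lemma left_ucont_translate a f : left_ucont f ->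
  left_ucont (fun x => f (a * x)%g).
Proof.
move=> uf e e0; have := nbhs1_conj (@compact_set1 G a) (uf e e0).
apply: filterS => u h x /=; have := h a erefl (a * x)%g.
by rewrite -!mulgA mulKg.
Qed.

Lemma left_ucontZ c f : left_ucont f -> left_ucont (fun x => c * f x).
Proof.
move=> uf e e0; have c0 : 0 < `|c| + 1 by rewrite ltr_wpDl.
apply: filterS (uf _ (divr_gt0 e0 c0)) => u h x; rewrite -mulrBr normrM.
rewrite (@le_trans _ _ ((`|c| + 1) * (e / (`|c| + 1))))//.
  by rewrite ler_pM// lerDl.
by rewrite mulrCA divff ?mulr1// gt_eqF.
Qed.

Lemma left_ucont_sum (T : Type) (w : seq T) (F : T -> G -> R) :
  (forall t, left_ucont (F t)) -> left_ucont (fun x => \sum_(t <- w) F t x).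
Proof.
move=> h; elim: w => [|t w IH] e e0.
  by apply: filterE => u x; rewrite !big_nil subrr normr0 ltW.
have e20 : 0 < e / 2 by rewrite divr_gt0.
apply: filterS2 (h t _ e20) (IH _ e20) => u h1 h2 x; rewrite !big_cons.
rewrite opprD addrACA (le_trans (ler_normD _ _))// [leRHS]splitr.
by apply: lerD; [exact: h1|exact: h2].
Qed.

Lemma left_ucont_uniform_limit f :
  (forall e, 0 < e -> exists2 g, left_ucont g & forall x, `|f x - g x| <= e) ->
  left_ucont f.
Proof.
move=> h e e0; have e30 : 0 < e / 3 by rewrite divr_gt0.
have [g ug fg] := h _ e30; apply: filterS (ug _ e30) => u hu x.
have := hu x; have := fg x; have := fg (u * x)%g; rewrite !ler_norml.
by move=> /andP[? ?] /andP[? ?] /andP[? ?]; apply/andP; split; lra.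
Qed.

End UniformContinuity.

(** * Integrals of bounded continuous functions *)

Section Integral.
Variables (R : realType) (G : topologicalGroupType).
Implicit Types (x y z u : G) (C U V : set G) (f F : G -> R) (c : R).
Implicit Types (mu nu : probability (borel G) R).

Lemma open_borel U : open U -> measurable (U : set (borel G)).
Proof. by move=> oU; apply: sub_sigma_algebra. Qed.

Lemma compact_borel C : hausdorff_space G -> compact C ->
  measurable (C : set (borel G)).
Proof.
move=> hG cC; rewrite -(setCK C); apply: measurableC; apply: open_borel.
by apply: closed_openC; exact: compact_closed.
Qed.

Lemma continuous_borel_fun (phi : G -> G) : continuous phi ->
  measurable_fun setT (phi : borel G -> borel G).
Proof.
move=> cphi.
apply: (@measurability _ _ (borel G) (borel G) setT phi (@open G)) => //.
move=> _ [U oU <-]; rewrite setTI; apply: open_borel.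
by apply: open_comp => // x _; exact: cphi.
Qed.

Lemma continuous_measurable F : continuous F ->
  measurable_fun setT (F : borel G -> R).
Proof.
move=> cF; apply: (measurability _ (RGenOpens.measurableE R)) => //.
move=> _ [_ [a [b ->]] <-]; rewrite setTI; apply: open_borel.
by apply: open_comp => [x _|]; [exact: cF|exact: interval_open].
Qed.

Definition bcont F := continuous F /\ bdd F.

Lemma left_ucont_bcont f : bdd f -> left_ucont f -> bcont f.
Proof. by move=> bf uf; split => //; exact: left_ucont_continuous. Qed.

Lemma Cc_bcont f : Cc f -> bcont f.
Proof. by move=> cf; split; [exact: Cc_continuous|exact: Cc_bdd]. Qed.

Lemma bcont_cst c : bcont (fun=> c).
Proof. by split; [move=> ?; exact: cvg_cst|exists `|c|]. Qed.

Lemma bcontD F1 F2 : bcont F1 -> bcont F2 -> bcont (fun x => F1 x + F2 x).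
Proof.
move=> [c1 [M1 h1]] [c2 [M2 h2]]; split; last first.
  by exists (M1 + M2) => x; rewrite (le_trans (ler_normD _ _))// lerD.
by move=> x; apply: cvgD; [exact: c1|exact: c2].
Qed.

Lemma bcontZ c F : bcont F -> bcont (fun x => c * F x).
Proof.
move=> [c1 [M h]]; split; last first.
  by exists (`|c| * M) => x; rewrite normrM ler_wpM2l.
by move=> x; apply: cvgM; [exact: cvg_cst|exact: c1].
Qed.

Lemma bcontB F1 F2 : bcont F1 -> bcont F2 -> bcont (fun x => F1 x - F2 x).
Proof.
move=> h1 h2; have := bcontD h1 (bcontZ (-1) h2).
by congr bcont; apply/funext => x; rewrite mulN1r.
Qed.

Lemma bcont_sum (T : Type) (w : seq T) (F : T -> G -> R) :
  (forall t, bcont (F t)) -> bcont (fun x => \sum_(t <- w) F t x).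
Proof.
move=> h; elim: w => [|t w IH].
  by have := bcont_cst 0; congr bcont; apply/funext => x; rewrite big_nil.
by have := bcontD (h t) IH; congr bcont; apply/funext => x; rewrite big_cons.
Qed.

Lemma bcont_comp F (phi : G -> G) : bcont F -> continuous phi ->
  bcont (fun x => F (phi x)).
Proof.
move=> [cF [M hM]] cphi; split; last by exists M => x; exact: hM.
by move=> x; apply: (@continuous_comp _ _ _ phi F); [exact: cphi|exact: cF].
Qed.

Lemma bcont_mulr F z : bcont F -> bcont (fun x => F (x * z)%g).
Proof. by move/bcont_comp; apply; exact: continuous_mulgr. Qed.

Lemma bcont_mull F z : bcont F -> bcont (fun x => F (z * x)%g).
Proof. by move/bcont_comp; apply; exact: continuous_mulgl. Qed.

Lemma bcont_mulgV F z : bcont F -> bcont (fun x => F (z * x^-1)%g).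
Proof. by move/bcont_comp; apply; exact: continuous_mulgV. Qed.

Lemma bcont_mulVg F z : bcont F -> bcont (fun x => F (x^-1 * z)%g).
Proof. by move/bcont_comp; apply; exact: continuous_mulVg. Qed.

Lemma bcont_integrable mu F (A : set (borel G)) : bcont F -> measurable A ->
  mu.-integrable A (EFin \o F : borel G -> \bar R).
Proof.
move=> [cF [M hM]] mA.
suff h : mu.-integrable setT (EFin \o F : borel G -> \bar R).
  by apply: integrableS h.
apply: measurable_bounded_integrable => //.
- exact: le_lt_trans (probability_le1 mu measurableT) (ltry _).
- exact: continuous_measurable.
- exists M; split; first exact: num_real.
  by move=> N MN x _; exact: le_trans (hM x) (ltW MN).
Qed.

Lemma integ_cst mu c : integ mu (fun=> c) = c.
Proof.
by rewrite /integ Rintegral_cst// [X in fine X](probability_setT mu) /= mulr1.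
Qed.

Lemma integD mu F1 F2 : bcont F1 -> bcont F2 ->
  integ mu (fun x => F1 x + F2 x) = integ mu F1 + integ mu F2.
Proof. by move=> h1 h2; apply: RintegralD => //; exact: bcont_integrable. Qed.

Lemma integB mu F1 F2 : bcont F1 -> bcont F2 ->
  integ mu (fun x => F1 x - F2 x) = integ mu F1 - integ mu F2.
Proof. by move=> h1 h2; apply: RintegralB => //; exact: bcont_integrable. Qed.

Lemma integZ mu c F : bcont F -> integ mu (fun x => c * F x) = c * integ mu F.
Proof. by move=> h; apply: RintegralZl => //; exact: bcont_integrable. Qed.

Lemma integ_sum mu (T : Type) (w : seq T) (F : T -> G -> R) :
  (forall t, bcont (F t)) ->
  integ mu (fun x => \sum_(t <- w) F t x) = \sum_(t <- w) integ mu (F t).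
Proof.
move=> h; elim: w => [|t w IH].
  under [X in integ _ X]funext do rewrite big_nil.
  by rewrite integ_cst big_nil.
under [X in integ _ X]funext do rewrite big_cons.
by rewrite big_cons integD// ?IH//; exact: bcont_sum.
Qed.

Lemma le_integ mu F1 F2 : bcont F1 -> bcont F2 -> (forall x, F1 x <= F2 x) ->
  integ mu F1 <= integ mu F2.
Proof. by move=> h1 h2 h; apply: le_Rintegral => //; exact: bcont_integrable. Qed.

Lemma normr_integ_le mu F H : bcont F -> bcont H ->
  (forall x, `|F x| <= H x) -> `|integ mu F| <= integ mu H.
Proof.
move=> bF bH FH; rewrite ler_norml; apply/andP; split.
  rewrite -mulN1r -integZ//; apply: le_integ => //; first exact: bcontZ.
  by move=> x; have := FH x; rewrite mulN1r ler_norml => /andP[].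
by apply: le_integ => // x; exact: le_trans (ler_norm _) (FH x).
Qed.

Lemma integ_bound mu F c : bcont F -> (forall x, `|F x| <= c) ->
  `|integ mu F| <= c.
Proof.
move=> bF h; rewrite -[leRHS](integ_cst mu).
by apply: normr_integ_le => //; exact: bcont_cst.
Qed.

Lemma integ_dist mu F1 F2 c : bcont F1 -> bcont F2 ->
  (forall x, `|F1 x - F2 x| <= c) -> `|integ mu F1 - integ mu F2| <= c.
Proof.
by move=> b1 b2 h; rewrite -integB//; apply: integ_bound => //; exact: bcontB.
Qed.

Lemma integ_setC mu F (A : set (borel G)) : bcont F -> measurable A ->
  integ mu F = \int[mu]_(x in A) F x + \int[mu]_(x in ~` A) F x.
Proof.
move=> bF mA; rewrite /integ -(setUv A) Rintegral_setU//.
- exact: measurableC.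
- by rewrite setUv; exact: bcont_integrable.
- by apply/disj_setPS => x [].
Qed.

Lemma normr_Rintegral_le mu F (A : set (borel G)) c : bcont F -> measurable A ->
  (forall x, A x -> `|F x| <= c) ->
  `|\int[mu]_(x in A) F x| <= c * fine (mu A).
Proof.
move=> bF mA h; rewrite -(Rintegral_cst mu mA c).
apply: le_trans (le_normr_Rintegral mA (bcont_integrable mu bF mA)) _.
apply: le_Rintegral => //.
- by apply: integrable_norm; exact: bcont_integrable.
- by apply: (@bcont_integrable mu (fun=> c)) => //; exact: bcont_cst.
Qed.

Lemma measure_le_integ mu f (A : set (borel G)) : measurable A -> bcont f ->
  (forall x, 0 <= f x) -> (forall x, A x -> f x = 1) ->
  fine (mu A) <= integ mu f.
Proof.
move=> mA bf f0 f1; rewrite (integ_setC mu bf mA).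
have -> : \int[mu]_(x in A) f x = fine (mu A).
  rewrite -[RHS]mul1r -(Rintegral_cst mu mA 1).
  by apply: eq_Rintegral => x; rewrite inE => Ax; exact: f1.
by rewrite lerDl Rintegral_ge0.
Qed.

Lemma integ_le_measure mu f (A : set (borel G)) : measurable A -> bcont f ->
  (forall x, `|f x| <= 1) -> (forall x, f x != 0 -> A x) ->
  integ mu f <= fine (mu A).
Proof.
move=> mA bf f1 f0.
have -> : integ mu f = \int[mu]_(x in A) f x.
  rewrite /integ [RHS]Rintegral_mkcond; apply: eq_Rintegral => x _.
  rewrite /patch; case: ifPn => //; rewrite notin_setE => nA.
  by apply/eqP; apply: contrapT => /negP /f0.
rewrite -[leRHS]mul1r; apply: le_trans (ler_norm _) _.
exact: normr_Rintegral_le.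
Qed.

Lemma integ_comp mu (phi psi : G -> G) F : bcont F -> continuous phi ->
    cancel psi phi ->
    (forall A, measurable (A : set (borel G)) ->
      mu [set phi a | a in A] = mu A) ->
  integ mu (fun x => F (phi x)) = integ mu F.
Proof.
move=> bF cphi k1 hmu; have mphi := continuous_borel_fun cphi.
rewrite /integ /Rintegral; congr fine.
transitivity (\int[pushforward mu (phi : borel G -> borel G)]_x (F x)%:E)%E.
  rewrite integral_pushforward//.
  - by apply/measurable_EFinP; apply: continuous_measurable; case: bF.
  - rewrite preimage_setT.
    exact: (bcont_integrable mu (bcont_comp bF cphi) measurableT).
apply: eq_measure_integral => A mA _; rewrite /pushforward.
etransitivity.
  by apply/esym/hmu; rewrite -(setTI (_ @^-1` _)); exact: mphi.
congr (mu _); apply/seteqP; split=> x /=; first by move=> [a Aa <-].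
by move=> Ax; exists (psi x); rewrite /= k1.
Qed.

Lemma integ_right_invariant mu (K : set G) k F :
  right_invariant K mu -> K k -> bcont F ->
  integ mu (fun x => F (x * k)%g) = integ mu F.
Proof.
move=> hmu Kk bF.
apply: (integ_comp (phi := fun x => (x * k)%g)
  (psi := fun x => (x * k^-1)%g)) => //.
- exact: continuous_mulgr.
- by move=> x; rewrite mulgVK.
- by move=> A mA; exact: hmu.
Qed.

Lemma integ_left_invariant mu (K : set G) k F :
  left_invariant K mu -> K k -> bcont F ->
  integ mu (fun x => F (k * x)%g) = integ mu F.
Proof.
move=> hmu Kk bF.
apply: (integ_comp (phi := fun x => (k * x)%g)
  (psi := fun x => (k^-1 * x)%g)) => //.
- exact: continuous_mulgl.
- by move=> x; rewrite mulVKg.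
- by move=> A mA; exact: hmu.
Qed.

Lemma integ_dirac mu F : bcont F ->
  (forall A, measurable (A : set (borel G)) -> mu A = \d_(1%g : borel G) A) ->
  integ mu F = F 1%g.
Proof.
move=> bF hmu; rewrite /integ /Rintegral.
rewrite (eq_measure_integral (\d_(1%g : borel G))); last first.
  by move=> A mA _; exact: hmu.
rewrite integral_dirac//; last first.
  by apply/measurable_EFinP; apply: continuous_measurable; case: bF.
by rewrite diracT mul1e.
Qed.

End Integral.

(** * Radon measures as limits of finite measures, and iterated integrals *)

Section Discretization.
Variables (R : realType) (G : topologicalGroupType).
Implicit Types (x y z u : G) (C U V : set G) (f F : G -> R).
Implicit Types (mu nu : probability (borel G) R).

(** The translates [U g] for [g] in [s] are made disjoint one after the other,
    and the mass of each piece is put at the corresponding [g]. The weights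
    depend on [mu], [U] and the cover only, so that they serve all [F] at
    once. *)
Lemma discretize_on_cover mu U (e : R) (s : seq G) (A : set (borel G)) :
    open U -> measurable A ->
    (forall x, A x -> exists2 g, g \in s & U (x * g^-1)%g) ->
  exists w : seq (R * G), forall F, bcont F ->
    (forall u x, U u -> `|F (u * x)%g - F x| <= e) ->
    `|\int[mu]_(x in A) F x - \sum_(p <- w) p.1 * F p.2| <= e * fine (mu A).
Proof.
move=> oU; elim: s A => [|g s IH] A mA hA.
  have -> : A = set0 by rewrite -subset0 => x /hA[].
  exists [::] => F _ _.
  by rewrite big_nil Rintegral_set0 subr0 normr0 measure0 mulr0.
have oUg : open [set x | U (x * g^-1)%g].
  by apply: open_comp => // x _; exact: continuous_mulgr.
pose B : set (borel G) := A `&` [set x | U (x * g^-1)%g].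
pose B' : set (borel G) := A `\` [set x | U (x * g^-1)%g].
have mB : measurable B by apply: measurableI => //; exact: open_borel.
have mB' : measurable B' by apply: measurableD => //; exact: open_borel.
have AE : A = B `|` B' by rewrite /B /B' setUIDK.
have dB : [disjoint B & B'].
  by apply/disj_setPS => x [[_ h] [_ h']]; exact: h'.
have [w hw] : exists w : seq (R * G), forall F, bcont F ->
    (forall u x, U u -> `|F (u * x)%g - F x| <= e) ->
    `|\int[mu]_(x in B') F x - \sum_(p <- w) p.1 * F p.2|
      <= e * fine (mu B').
  apply: IH => // x [Ax nUx]; have [g' + Ug'] := hA x Ax.
  rewrite inE => /orP[/eqP gg'|sg']; last by exists g'.
  by case: nUx; rewrite /= -gg'.
exists ((fine (mu B), g) :: w) => F bF hF; rewrite big_cons /=.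
have -> : \int[mu]_(x in A) F x =
    \int[mu]_(x in B) F x + \int[mu]_(x in B') F x.
  rewrite AE Rintegral_setU//; apply: bcont_integrable => //.
  exact: measurableU.
have muA : fine (mu A) = fine (mu B) + fine (mu B').
  rewrite AE measureU//; last by apply/eqP; rewrite -disj_set2E.
  by rewrite fineD//; apply: fin_num_measure.
rewrite muA mulrDr opprD addrACA; apply: le_trans (ler_normD _ _) _.
apply: lerD; last exact: hw.
have -> : fine (mu B) * F g = \int[mu]_(x in B) (F g).
  by rewrite Rintegral_cst// mulrC.
rewrite -RintegralB//; [|exact: bcont_integrable|].
  apply: (@normr_Rintegral_le _ _ mu (fun x => F x - F g)) => //.
    by apply: bcontB => //; exact: bcont_cst.
  by move=> x [_ /= Ux]; have := hF _ g Ux; rewrite mulgVK.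
by apply: (@bcont_integrable _ _ mu (fun=> F g)) => //; exact: bcont_cst.
Qed.

Hypothesis hG : hausdorff_space G.

Lemma radon_tight mu (e : R) : radon mu -> 0 < e ->
  exists2 C, compact C & fine (mu (C : set (borel G))) > 1 - e.
Proof.
move=> rmu e0; have := radon_inner rmu openT.
rewrite [X in X = _](probability_setT mu) => h.
have : ((1 - e)%:E < ereal_sup
    [set mu C | C in [set C | compact C /\ C `<=` setT]])%E.
  by rewrite -h lte_fin ltrBlDr ltrDl.
move=> /ereal_sup_gt [_ [C [cC _] <-]] h1; exists C => //.
by rewrite -lte_fin fineK// fin_num_measure//; exact: compact_borel.
Qed.

(** A compact set carries all but little of the mass of [mu] and is covered by
    finitely many translates of [U]. *)
Lemma discretize mu U (M e : R) : radon mu -> nbhs (1%g : G) U ->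
    0 < M -> 0 < e ->
  exists w : seq (R * G), forall F, continuous F -> (forall x, `|F x| <= M) ->
    (forall u x, U u -> `|F (u * x)%g - F x| <= e) ->
    `|integ mu F - \sum_(p <- w) p.1 * F p.2| <= 2 * e.
Proof.
move=> rmu U1 M0 e0.
have [C cC hC] := radon_tight rmu (divr_gt0 e0 M0).
have mC := compact_borel hG cC.
have : C `<=` cover setT (fun g => [set x | U° (x * g^-1)%g]).
  by move=> x _; exists x => //=; rewrite mulgV.
have := cC; rewrite compact_cover.
move=> /(_ G setT (fun g => [set x | U° (x * g^-1)%g])) cov.
move=> /cov [g _|D _ hD].
  apply: open_comp; last exact: open_interior.
  by move=> x _; exact: continuous_mulgr.
have [w hw] := discretize_on_cover mu e (s := finmap.enum_fset D)
  (@open_interior _ U) mC (fun x Cx => let: ex_intro2 g Dg Ug := hD x Cx in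
    ex_intro2 _ _ g Dg Ug).
exists w => F cF hM hF; have bF : bcont F by split => //; exists M.
rewrite (integ_setC mu bF mC) addrAC (le_trans (ler_normD _ _))//.
rewrite mulr_natl mulr2n lerD//.
  apply: le_trans (hw F bF _) _; first by move=> u x /interior_subset; exact: hF.
  rewrite ger_pMr// -lee_fin fineK ?fin_num_measure//; exact: probability_le1.
apply: le_trans (@normr_Rintegral_le _ _ mu F _ M bF _ _) _ => //.
  exact: measurableC.
rewrite probability_setC// fineB ?fin_num_measure//= mulrC -ler_pdivlMr//.
by rewrite lerBlDl -lerBlDr ltW.
Qed.

Lemma integ_fiber_left_ucont mu f : radon mu -> bdd f -> left_ucont f ->
  left_ucont (fun h => integ mu (fun g => f (g * h)%g)).
Proof.
move=> rmu bf uf; apply: left_ucont_uniform_limit => e e0.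
have [M M0 hM] := bdd_gt0 bf; have e20 : 0 < e / 2 by rewrite divr_gt0.
have [w hw] := discretize rmu (uf _ e20) M0 e20.
exists (fun h => \sum_(p <- w) p.1 * f (p.2 * h)%g).
  by apply: left_ucont_sum => p; apply: left_ucontZ; exact: left_ucont_translate.
move=> h; have := hw (fun g => f (g * h)%g); rewrite mulrCA divff ?mulr1//.
apply.
- by case: (bcont_mulr h (left_ucont_bcont bf uf)).
- by move=> x; exact: hM.
- by move=> u x Uu; rewrite -mulgA; exact: Uu.
Qed.

Lemma integ_orbit_left_ucont nu f (psi : G -> G) : bdd f -> left_ucont f ->
  continuous psi -> left_ucont (fun g => integ nu (fun y => f (g * psi y)%g)).
Proof.
move=> bf uf cpsi e e0; apply: filterS (uf e e0) => u hu x.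
have bct z : bcont (fun y => f (z * psi y)%g).
  exact: (bcont_comp (bcont_mull z (left_ucont_bcont bf uf)) cpsi).
by apply: integ_dist => // y; rewrite -mulgA; exact: hu.
Qed.

Lemma integ_fiber_bcont mu f (psi : G -> G) : radon mu -> bdd f ->
  left_ucont f -> continuous psi ->
  bcont (fun y => integ mu (fun g => f (g * psi y)%g)).
Proof.
move=> rmu bf uf cpsi.
apply: (@bcont_comp _ _ (fun h => integ mu (fun g => f (g * h)%g))) => //.
apply: left_ucont_bcont; last exact: integ_fiber_left_ucont.
have [M hM] := bf; exists M => h; apply: integ_bound => //.
exact: (bcont_mulr h (left_ucont_bcont bf uf)).
Qed.

Lemma integ_orbit_bcont nu f (psi : G -> G) : bdd f -> left_ucont f ->
  continuous psi -> bcont (fun g => integ nu (fun y => f (g * psi y)%g)).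
Proof.
move=> bf uf cpsi; apply: left_ucont_bcont; last exact: integ_orbit_left_ucont.
have [M hM] := bf; exists M => g; apply: integ_bound => //.
exact: (bcont_comp (bcont_mull g (left_ucont_bcont bf uf)) cpsi).
Qed.

(** For a finite combination of point masses in place of [mu] the exchange is
    linearity of the integral; the error is uniform in [y] because all functions
    [f (. (psi y))] have the modulus of continuity of [f]. *)
Lemma integ_swap mu nu f (psi : G -> G) : radon mu -> bdd f -> left_ucont f ->
    continuous psi ->
  integ mu (fun g => integ nu (fun y => f (g * psi y)%g)) =
  integ nu (fun y => integ mu (fun g => f (g * psi y)%g)).
Proof.
move=> rmu bf uf cpsi; apply: eq_dist_le => e e0.
have [M M0 hM] := bdd_gt0 bf; have e40 : 0 < e / 4 by rewrite divr_gt0.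
have [w hw] := discretize rmu (uf _ e40) M0 e40.
have bcf := left_ucont_bcont bf uf.
have bc1 z : bcont (fun y => f (z * psi y)%g).
  exact: (bcont_comp (bcont_mull z bcf) cpsi).
pose S := \sum_(p <- w) p.1 * integ nu (fun y => f (p.2 * psi y)%g).
have h1 : `|integ mu (fun g => integ nu (fun y => f (g * psi y)%g)) - S|
    <= 2 * (e / 4).
  apply: hw.
  - by case: (integ_orbit_bcont nu bf uf cpsi).
  - by move=> x; exact: integ_bound.
  - by move=> u x Uu; apply: integ_dist => // y; rewrite -mulgA; exact: Uu.
have h2 : `|integ nu (fun y => integ mu (fun g => f (g * psi y)%g)) - S|
    <= 2 * (e / 4).
  have -> : S = integ nu (fun y => \sum_(p <- w) p.1 * f (p.2 * psi y)%g).
    rewrite integ_sum; last by move=> p; exact: bcontZ.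
    by apply: eq_bigr => p _; rewrite integZ.
  apply: integ_dist.
  - exact: integ_fiber_bcont.
  - by apply: bcont_sum => p; exact: bcontZ.
  - move=> y; apply: hw; first by case: (bcont_mulr (psi y) bcf).
      by move=> x; exact: hM.
    by move=> u x Uu; rewrite -mulgA; exact: Uu.
move: h1 h2; rewrite !ler_norml => /andP[? ?] /andP[? ?].
by apply/andP; split; lra.
Qed.

End Discretization.

(** * Bump functions, and invariance of Radon measures *)

Section Bump.
Variables (R : realType) (G : topologicalGroupType).
Implicit Types (x y z u : G) (A C U V : set G) (f F : G -> R).
Implicit Types (mu nu : probability (borel G) R).
Hypothesis hG : hausdorff_space G.

Lemma compact_supp_sub f C : compact C -> (forall x, f x != 0 -> C x) ->
  compact (closure [set x | f x != 0]).
Proof.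
move=> cC hC; apply: (subclosed_compact _ cC); first exact: closed_closure.
have /closure_id -> : closed C by exact: compact_closed.
exact: closureS.
Qed.

Lemma Cc_comp f (phi psi : G -> G) : continuous phi -> continuous psi ->
  cancel phi psi -> Cc f -> Cc (fun x => f (phi x)).
Proof.
move=> cphi cpsi k1 cf.
have cS : compact (psi @` closure [set x | f x != 0]).
  by apply: continuous_compact; [exact: continuous_subspaceT|case: cf].
apply: compact_supp_Cc; first by case: (bcont_comp (Cc_bcont cf) cphi).
apply: (compact_supp_sub cS) => x /= fx; exists (phi x); last exact: k1.
exact: supp_neq0.
Qed.

Lemma Cc_mull f k : Cc f -> Cc (fun x => f (k * x)%g).
Proof.
apply: (Cc_comp (psi := fun x => (k^-1 * x)%g)); try exact: continuous_mulgl.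
by move=> x; rewrite mulKg.
Qed.

Lemma Cc_mulr f k : Cc f -> Cc (fun x => f (x * k)%g).
Proof.
apply: (Cc_comp (psi := fun x => (x * k^-1)%g)); try exact: continuous_mulgr.
by move=> x; rewrite mulgK.
Qed.

Hypothesis lG : locally_compact [set: G].

Lemma point_bump U : nbhs (1%g : G) U ->
  exists2 f : G -> R, Cc f & [/\ forall x, 0 <= f x <= 1, f 1%g = 1 &
    forall x, f x != 0 -> U x].
Proof.
move=> U1.
have [N N1 [cN clN]] :
    exists2 N, nbhs (1%g : G) N & compact N /\ closed N.
  have := lG (I : [set: G] 1%g).
  case=> N N1 hN; exists N => //.
  by apply: (@filterS _ (nbhs (1%g : G)) _ _ _ _ N1) => u; exact.
pose B := ~` (N `&` U)°.
have clB : closed B by apply: open_closedC; exact: open_interior.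
have nB1 : ~ B 1%g by apply; exact: filterI.
have := @locally_compact_completely_regular G R lG hG _ _ clB nB1.
move=> /(@uniform_separatorP G R) [f [cf f01 f0 f1]].
have h01 x : 0 <= f x <= 1.
  by have := f01 (f x); rewrite /= in_itv /=; apply; exists x.
have hU x : 1 - f x != 0 -> (N `&` U) x.
  move=> fx; apply: contrapT => nx; move/eqP : fx; apply.
  rewrite (f1 (f x)) ?subrr//; exists x => // /interior_subset; exact: nx.
exists (fun x => 1 - f x).
  apply: compact_supp_Cc.
    by move=> x; apply: cvgB; [exact: cvg_cst|exact: cf].
  by apply: (compact_supp_sub cN) => x /hU[].
split; first by move=> x; have := h01 x; lra.
  by rewrite (f0 (f 1%g)) ?subr0//; exists 1%g.
by move=> x /hU[].
Qed.

(** The bump is [x |-> sup_(c in C) p (x c^-1)] for a bump [p] at the neutral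
    element. Left uniform continuity passes from [p] to the supremum, and the
    supremum is invariant under the right translations that preserve [C]: for
    [C = K] this gives a test function on [G / K]. *)
Lemma compact_bump C U : compact C -> C !=set0 -> nbhs (1%g : G) U ->
  exists2 f : G -> R, Cc f & [/\ forall x, 0 <= f x <= 1,
    forall c, C c -> f c = 1,
    forall x, f x != 0 -> exists2 c, C c & U (x * c^-1)%g &
    forall k, (forall c, C c <-> C (c * k)%g) -> forall x, f (x * k)%g = f x].
Proof.
move=> cC [c0 Cc0] U1; have [p cp [p01 p1 pU]] := point_bump U1.
pose S x := [set p (x * c^-1)%g | c in C].
have ubS x : ubound (S x) 1.
  by move=> _ [c _ <-]; have /andP[] := p01 (x * c^-1)%g.
have neS x : S x !=set0 by exists (p (x * c0^-1)%g), c0.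
have leS x c : C c -> p (x * c^-1)%g <= sup (S x).
  by move=> Cc; apply: ub_le_sup; [exists 1|exists c].
have S01 x : 0 <= sup (S x) <= 1.
  rewrite ge_sup// andbT (le_trans _ (leS x c0 Cc0))//.
  by have /andP[] := p01 (x * c0^-1)%g.
have Ssupp x : sup (S x) != 0 -> exists2 c, C c & p (x * c^-1)%g != 0.
  move=> Sx; apply: contrapT => h; move/eqP : Sx; apply; apply/eqP.
  rewrite eq_le; have /andP[-> _] := S01 x; rewrite andbT.
  apply: ge_sup => // _ [c Cc <-].
  by have [->//|pc] := eqVneq (p (x * c^-1)%g) 0; case: h; exists c.
have uS : left_ucont (fun x => sup (S x)).
  move=> e e0; apply: filterS (Cc_left_ucont cp e0) => u hu x /=.
  have half y z : (forall c, C c -> p (y * c^-1)%g <= p (z * c^-1)%g + e) ->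
      sup (S y) <= sup (S z) + e.
    move=> h; apply: ge_sup => // _ [c Cc <-]; rewrite (le_trans (h c Cc))//.
    by rewrite lerD2r; exact: leS.
  rewrite ler_distl; apply/andP; split; last first.
    apply: half => c Cc; have := hu (x * c^-1)%g.
    by rewrite mulgA ler_distl => /andP[].
  rewrite lerBlDr; apply: half => c Cc; have := hu (x * c^-1)%g.
  by rewrite mulgA ler_distl lerBlDr => /andP[].
exists (fun x => sup (S x)).
  apply: compact_supp_Cc; first exact: left_ucont_continuous.
  apply: (compact_supp_sub (compact_mulg cp.2 cC)) => x /Ssupp[c Cc hp].
  exists ((x * c^-1)%g, c); last by rewrite /= mulgVK.
  by split => //; exact: supp_neq0.
split => //.
- move=> c Cc; apply/eqP; rewrite eq_le; have /andP[_ ->] := S01 c.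
  by have := leS c c Cc; rewrite mulgV p1.
- by move=> x /Ssupp[c Cc /pU]; exists c.
- move=> k hk x; congr sup; apply/seteqP; split=> _ [c Cc <-].
    exists (c * k^-1)%g; first by apply/hk; rewrite mulgVK.
    by rewrite invgM invgK mulgA.
  by exists (c * k)%g; [exact: (hk c).1|rewrite invgM mulgA mulgK].
Qed.

(** On open sets the measure is recovered from the integrals of bump functions
    by inner regularity, and on Borel sets from open sets by outer regularity;
    each regularity gives one inequality, and [phi] and [psi] play symmetric
    roles. *)
Lemma radon_invariant mu (phi psi : G -> G) : radon mu ->
    continuous phi -> continuous psi -> cancel phi psi -> cancel psi phi ->
    (forall f, Cc f -> integ mu (fun x => f (phi x)) = integ mu f) ->
  forall A, measurable (A : set (borel G)) -> mu [set phi a | a in A] = mu A.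
Proof.
move=> rmu cphi cpsi k1 k2 hmu.
have le_open (p : G -> G) : continuous p ->
    (forall f, Cc f -> integ mu (fun x => f (p x)) = integ mu f) ->
    forall V, open V ->
    (mu (V : set (borel G)) <= mu (p @^-1` V : set (borel G)))%E.
  move=> cp hp V oV; rewrite (radon_inner rmu oV).
  have oW : open (p @^-1` V) by apply: open_comp => // x _; exact: cp.
  apply: ge_ereal_sup => _ [C [cC CV] <-].
  have [->|C0] := eqVneq C set0; first by rewrite measure0.
  have mC := compact_borel hG cC.
  have [f cf [f01 f1 fC _]] :=
    compact_bump cC ((set0P C).1 C0) (nbhs1_compact_mul cC oV CV).
  have bf := Cc_bcont cf.
  rewrite -[leLHS]fineK ?fin_num_measure//.
  rewrite -[leRHS]fineK ?fin_num_measure ?lee_fin//; last exact: open_borel.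
  apply: (@le_trans _ _ (integ mu f)).
    by apply: measure_le_integ => // x; have /andP[] := f01 x.
  rewrite -hp//; apply: integ_le_measure; first exact: open_borel.
  - exact: bcont_comp.
  - by move=> x; have /andP[? ?] := f01 (p x); rewrite /= ger0_norm.
  - by move=> x /= /fC[c Cc hc]; have := hc c Cc; rewrite mulgVK.
have hmu' f : Cc f -> integ mu (fun x => f (psi x)) = integ mu f.
  move=> cf; rewrite -[LHS]hmu; last exact: Cc_comp cf.
  by congr integ; apply/funext => x /=; rewrite k1.
have mim (p q : G -> G) : continuous q -> cancel p q -> cancel q p ->
    forall A, measurable (A : set (borel G)) ->
    measurable (p @` A : set (borel G)).
  move=> cq pq qp A mA; rewrite (image_preimage_can A pq qp).
  rewrite -(setTI (_ @^-1` _)); exact: (continuous_borel_fun cq).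
have le (p q : G -> G) : continuous p -> continuous q -> cancel p q ->
    cancel q p ->
    (forall f, Cc f -> integ mu (fun x => f (p x)) = integ mu f) ->
    forall A, measurable (A : set (borel G)) ->
    (mu (p @` A : set (borel G)) <= mu A)%E.
  move=> cp cq pq qp hp A mA; rewrite [leRHS](radon_outer rmu mA).
  apply: le_ereal_inf_tmp => _ [U [oU AU] <-].
  have oW : open (p @` U).
    rewrite (image_preimage_can U pq qp).
    by apply: open_comp => // x _; exact: cq.
  apply: (@le_trans _ _ (mu (p @` U : set (borel G)))).
    apply: le_measure; rewrite ?inE; last exact: image_subset.
      exact: (mim p q).
    exact: open_borel.
  apply: le_trans (le_open p cp hp _ oW) _.
  by rewrite (image_preimage_can U pq qp) -comp_preimage
    (_ : q \o p = id)//; apply/funext => x /=; rewrite pq.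
move=> A mA; apply/eqP; rewrite eq_le (le phi psi)//=.
have := le psi phi cpsi cphi k2 k1 hmu' _ (mim phi psi cpsi k1 k2 A mA).
rewrite image_comp (_ : _ @` A = A)// -[RHS]image_id.
by apply: eq_imagel => x _ /=; rewrite k1.
Qed.

End Bump.

(** * Restricted convolution semigroups *)

Section Restricted.
Variables (R : realType) (G : topologicalGroupType) (K : set G).
Variable mut : R -> probability (borel G) R.
Implicit Types (x y z u : G) (C U V : set G) (f F : G -> R).
Implicit Types (mu nu : probability (borel G) R).
Hypothesis hG : hausdorff_space G.
Hypothesis lG : locally_compact [set: G].
Hypothesis cK : compact_subgroup K.
Hypothesis mutP : restricted_convolution_semigroup K mut.

(** Tested on continuous functions rather than expressed by the mass of the
    complement of [U K], because it is integrals of such functions, depending on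
    a parameter, that have to be bounded uniformly in the parameter. *)
Definition concentrated mu U (M e : R) := forall F, bcont F ->
  (forall x, `|F x| <= M) -> (forall u k, U u -> K k -> `|F (u * k)%g| <= e) ->
  `|integ mu F| <= 2 * e.

(** For a right [K]-invariant bump [p] with [p = 1] on [K] and support in [U K],
    such a function is bounded by [e + M (1 - p)], whose integral tends to
    [e]. *)
Lemma concentration U (M e : R) : nbhs (1%g : G) U -> 0 < M -> 0 < e ->
  \forall s \near 0^'+, concentrated (mut s) U M e.
Proof.
move=> U1 M0 e0.
have K0 : K !=set0 by exists 1%g; exact: subgroup_one.
have [p cp [p01 p1 pU pK]] :=
  compact_bump R hG lG (subgroup_compact cK) K0 U1.
have pinv : right_invariant_fun K p.
  move=> x k Kk; apply: pK => c; split; first by move=> Kc; exact: subgroup_mul.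
  by move=> Kck; rewrite -(mulgK k c); apply: subgroup_mul => //;
    exact: subgroup_inv.
have /cvgrPdist_lt /(_ (e / M) (divr_gt0 e0 M0)) := rcs_continuous mutP cp pinv.
apply: filterS => s; rewrite (p1 _ (subgroup_one cK)) => hs F bF FM Fe.
have bp := Cc_bcont cp.
have b1p : bcont (fun x => 1 - p x) by apply: bcontB => //; exact: bcont_cst.
pose H x := e + M * (1 - p x).
have bH : bcont H by apply: bcontD; [exact: bcont_cst|exact: bcontZ].
have FH x : `|F x| <= H x.
  rewrite /H; have /andP[p0 p1'] := p01 x.
  have [px|px] := eqVneq (p x) 0.
    by rewrite px subr0 mulr1 (le_trans (FM x))// lerDr ltW.
  have [c Kc Uc] := pU x px; have := Fe _ _ Uc Kc; rewrite mulgVK => Fx.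
  by rewrite (le_trans Fx)// lerDl mulr_ge0 ?subr_ge0// ltW.
apply: le_trans (normr_integ_le _ bF bH FH) _.
rewrite integD ?integZ ?integB ?integ_cst//; try exact: bcont_cst; last first.
  exact: bcontZ.
suff : M * (1 - integ (mut s) p) <= e by lra.
by rewrite mulrC -ler_pdivlMr// (le_trans (ler_norm _))// ltW.
Qed.

(** The convolution of [f] with the image of [mut s] under inversion. As
    [mut s] is right [K]-invariant and nearly carried by [K], this is a nearly
    averaged and exactly right [K]-invariant version of [f]. *)
Definition right_smooth (s : R) f x :=
  integ (mut s) (fun y => f (x * y^-1)%g).

Lemma right_smooth_invariant s f : 0 < s -> bcont f ->
  right_invariant_fun K (right_smooth s f).
Proof.
move=> s0 bf x k Kk; rewrite /right_smooth.
rewrite -(integ_right_invariant (rcs_right_invariant mutP s0) Kk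
  (bcont_mulgV (x * k)%g bf)).
by congr integ; apply/funext => y; rewrite invgM !mulgA mulgK.
Qed.

Lemma right_smooth_approx f (e : R) :
  bdd f -> left_ucont f -> right_ucont f -> 0 < e ->
  \forall s \near 0^'+, forall mu, radon mu -> right_invariant K mu ->
    `|integ mu (right_smooth s f) - integ mu f| <= e.
Proof.
move=> bf uf rf e0; have e20 : 0 < e / 2 by rewrite divr_gt0.
have [M M0 hM] := bdd_gt0 bf; have M20 : 0 < M + M by rewrite addr_gt0.
have bcf := left_ucont_bcont bf uf.
have U1 := nbhs1_invg (rf _ e20).
apply: filterS (concentration U1 M20 e20) => s hs mu rmu imu.
have cinv : continuous (fun y : G => (y^-1)%g) by exact: invg_continuous.
have bA := integ_fiber_bcont hG rmu bf uf cinv.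
rewrite /right_smooth (integ_swap hG _ rmu bf uf cinv).
rewrite -(integ_cst (mut s) (integ mu f)) -integB//; last exact: bcont_cst.
rewrite (_ : e = 2 * (e / 2)); last by rewrite mulrC divfK.
apply: hs.
- by apply: bcontB => //; exact: bcont_cst.
- move=> y; rewrite (le_trans (ler_normB _ _))// lerD//; apply: integ_bound => //.
  exact: bcont_mulr.
- move=> u k Uu Kk; rewrite invgM.
  (* the invariance of [mu] absorbs [k^-1] and leaves the small translation *)
  have := integ_right_invariant imu (subgroup_inv cK Kk)
    (bcont_mulr (u^-1)%g bcf).
  under [X in integ mu X = _ -> _]funext do rewrite -mulgA.
  by move=> ->; apply: integ_dist => //; exact: bcont_mulr.
Qed.

(** Both sides change little when [f] is replaced by [right_smooth r f], for
    which the law is [rcs_law]: on the right, smoothing [f] smooths the function [F]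
    of [h], by an exchange of integrals, so that [right_smooth_approx] applies
    to [F] and [mut t]. *)
Lemma restricted_law s t f : 0 < s -> 0 < t ->
  bdd f -> left_ucont f -> right_ucont f ->
  integ (mut (s + t)) f =
  integ (mut t) (fun h => integ (mut s) (fun g => f (g * h)%g)).
Proof.
move=> s0 t0 bf uf rf; have bcf := left_ucont_bcont bf uf.
have st0 : 0 < s + t by rewrite addr_gt0.
have rs := rcs_radon mutP (ltW s0).
pose F h := integ (mut s) (fun g => f (g * h)%g).
have [_ bF] : bcont F.
  by apply: (integ_fiber_bcont hG rs bf uf (psi := id)) => x; exact: cvg_id.
have uF : left_ucont F by exact: integ_fiber_left_ucont.
have rF : right_ucont F.
  move=> e e0; apply: filterS (rf e e0) => u hu h.
  apply: integ_dist; [exact: bcont_mulr|exact: bcont_mulr|].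
  by move=> g; rewrite mulgA; exact: hu.
rewrite -/F; apply: eq_dist_le => e e0.
have e20 : 0 < e / 2 by rewrite divr_gt0.
have [r [[h1 h2] r0]] : exists r : R,
    ((forall mu, radon mu -> right_invariant K mu ->
      `|integ mu (right_smooth r f) - integ mu f| <= e / 2) /\
    (forall mu, radon mu -> right_invariant K mu ->
      `|integ mu (right_smooth r F) - integ mu F| <= e / 2)) /\ 0 < r.
  apply: (@filter_ex _ (0^'+ : set_system R)).
  apply: filterI; last exact: nbhs_right_gt.
  by apply: filterI; exact: right_smooth_approx.
have eqn : integ (mut (s + t)) (right_smooth r f) =
    integ (mut t) (right_smooth r F).
  rewrite (rcs_law mutP _ _ (ltW s0) (ltW t0)).
  - congr integ; apply/funext => h; rewrite /right_smooth.
    under [X in integ (mut s) X]funext => g.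
      under [X in integ _ X]funext do rewrite -mulgA.
      over.
    by rewrite (integ_swap hG _ rs bf uf (@continuous_mulgV G h)).
  - have cinv : continuous (fun y : G => (y^-1)%g) by exact: invg_continuous.
    apply: left_ucont_Cu; first by case: (integ_orbit_bcont (mut r) bf uf cinv).
    exact: integ_orbit_left_ucont.
  - exact: right_smooth_invariant.
have := h1 _ (rcs_radon mutP (ltW st0)) (rcs_right_invariant mutP st0).
have := h2 _ (rcs_radon mutP (ltW t0)) (rcs_right_invariant mutP t0).
rewrite eqn !ler_norml => /andP[? ?] /andP[? ?]; apply/andP; split; lra.
Qed.

Definition inversion_defect_le mu f (e : R) := forall h,
  `|integ mu (fun g => f (g * h)%g) - integ mu (fun x => f (x^-1 * h)%g)| <= e.

(** Both integrals are compared with the double integral of [f (g x^-1 h)],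
    inner in [g] as [A x], inner in [x] as [B g]. For [x = u k] near [K], the
    factor [k^-1] is absorbed by the right invariance of [mut s] and [A x] is
    close to [I]; for [g = u k] near [K], so is [k] and [B g] is close to [J].
    In the first case [u] acts in the middle of the product [g u^-1 h], which is
    why [g] too has to be near [K]: then the conjugate of [u^-1] by [g] is
    small. *)
Lemma small_time_inverse f (e : R) : bdd f -> left_ucont f -> 0 < e ->
  \forall s \near 0^'+, inversion_defect_le (mut s) f e.
Proof.
move=> bf uf e0; have bcf := left_ucont_bcont bf uf.
(* 14 = 12 + 2: the distances of the double integral to [I] and to [J] *)
pose d := e / 14; have d0 : 0 < d by rewrite divr_gt0.
have [M M0 hM] := bdd_gt0 bf; have M20 : 0 < M + M by rewrite addr_gt0.
pose U : set G := [set u | forall x, `|f (u * x)%g - f x| <= d].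
have U1 : nbhs (1%g : G) U by exact: uf.
pose W : set G := [set u | forall k, K k -> U (k * u^-1 * k^-1)%g].
have W1 : nbhs (1%g : G) W.
  exact: (nbhs1_invg (nbhs1_conj (subgroup_compact cK) U1)).
have UW1 : nbhs (1%g : G) (U `&` W) by exact: filterI.
have d60 : 0 < 6 * d by rewrite mulr_gt0.
have d30 : 0 < 3 * d by rewrite mulr_gt0.
near=> s => h.
have s0 : 0 < s by [].
have c1 : concentrated (mut s) (U `&` W) (M + M) d.
  by near: s; exact: concentration.
have c3 : concentrated (mut s) (U `&` W) (M + M) (3 * d).
  by near: s; exact: concentration.
have c6 : concentrated (mut s) (U `&` W) (M + M) (6 * d).
  by near: s; exact: concentration.
have rs := rcs_radon mutP (ltW s0); have is_ := rcs_right_invariant mutP s0.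
have cih : continuous (fun x : G => (x^-1 * h)%g) by exact: continuous_mulVg.
pose I := integ (mut s) (fun g => f (g * h)%g).
pose J := integ (mut s) (fun x => f (x^-1 * h)%g).
pose A x := integ (mut s) (fun g => f (g * (x^-1 * h))%g).
pose B g := integ (mut s) (fun x => f (g * (x^-1 * h))%g).
have bcg g : bcont (fun x => f (g * (x^-1 * h))%g).
  exact: (bcont_mulVg h (bcont_mull g bcf)).
have bA : bcont A by exact: integ_fiber_bcont.
have bB : bcont B by exact: integ_orbit_bcont.
have AB : integ (mut s) B = integ (mut s) A by exact: integ_swap.
have AI : `|integ (mut s) A - I| <= 12 * d.
  rewrite -(integ_cst (mut s) I) -integB//; last exact: bcont_cst.
  rewrite (_ : 12 * d = 2 * (6 * d)); last by lra.
  apply: c6; first by apply: bcontB => //; exact: bcont_cst.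
    move=> x; rewrite (le_trans (ler_normB _ _))// lerD//.
      by apply: integ_bound => //; exact: bcont_mulr.
    by apply: integ_bound => //; exact: bcont_mulr.
  move=> u k [Uu Wu] Kk; rewrite /A.
  have Kk' := subgroup_inv cK Kk.
  have -> : integ (mut s) (fun g => f (g * ((u * k)^-1 * h))%g) =
      integ (mut s) (fun g => f (g * (u^-1 * h))%g).
    rewrite -[RHS](integ_right_invariant is_ Kk'); last exact: bcont_mulr.
    by congr integ; apply/funext => g; rewrite invgM !mulgA.
  rewrite /I -integB; [|exact: bcont_mulr|exact: bcont_mulr].
  rewrite (_ : 6 * d = 2 * (3 * d)); last by lra.
  apply: c3; first by apply: bcontB; exact: bcont_mulr.
    by move=> x; rewrite (le_trans (ler_normB _ _))// lerD.
  (* [f (v l u^-1 h)], [f (l u^-1 h)], [f (l h)], [f (v l h)] are successively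
     within [d], the second step being the conjugation by [l] *)
  move=> v l [Uv Wv] Kl.
  have e1 := Uv (l * (u^-1 * h))%g; have e2 := Wu l Kl (l * h)%g.
  have e3 := Uv (l * h)%g; move: e1 e2 e3; rewrite -!mulgA mulKg.
  rewrite !ler_norml => /andP[? ?] /andP[? ?] /andP[? ?].
  by apply/andP; split; lra.
have BJ : `|integ (mut s) B - J| <= 2 * d.
  rewrite -(integ_cst (mut s) J) -integB//; last exact: bcont_cst.
  apply: c1; first by apply: bcontB => //; exact: bcont_cst.
    move=> x; rewrite (le_trans (ler_normB _ _))// lerD//.
      exact: integ_bound.
    by apply: integ_bound => //; exact: bcont_mulVg.
  move=> u k [Uu Wu] Kk; rewrite /B.
  have -> : integ (mut s) (fun x => f (u * k * (x^-1 * h))%g) =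
      integ (mut s) (fun x => f (u * (x^-1 * h))%g).
    rewrite -[LHS](integ_right_invariant is_ Kk)//.
    by congr integ; apply/funext => x; rewrite invgM !mulgA mulgK.
  by rewrite /J; apply: integ_dist => //; exact: bcont_mulVg.
have : e = 14 * d by rewrite /d; lra.
move: AI BJ; rewrite AB -/I -/J !ler_norml => /andP[? ?] /andP[? ?] ->.
by apply/andP; split; lra.
Unshelve. all: by end_near. Qed.

Lemma restricted_left_invariant t : 0 < t -> left_invariant K (mut t).
Proof.
move=> t0 A k mA Kk.
apply: (radon_invariant hG lG (phi := fun x => (k * x)%g)
  (psi := fun x => (k^-1 * x)%g)) => //.
- exact: (rcs_radon mutP (ltW t0)).
- exact: continuous_mulgl.
- exact: continuous_mulgl.
- by move=> x; rewrite mulKg.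
- by move=> x; rewrite mulVKg.
move=> f cf; have cfk := Cc_mull hG k cf.
have bf := Cc_bdd cf; have bfk := Cc_bdd cfk.
have uf := Cc_left_ucont cf; have ufk := Cc_left_ucont cfk.
have cid : continuous (id : G -> G) by move=> x; exact: cvg_id.
apply: eq_dist_le => e e0.
have e20 : 0 < e / 2 by rewrite divr_gt0.
near (0 : R)^'+ => s.
have h1 : inversion_defect_le (mut s) f (e / 2).
  by near: s; exact: small_time_inverse.
have h2 : inversion_defect_le (mut s) (fun x => f (k * x)%g) (e / 2).
  by near: s; exact: small_time_inverse.
have s0 : 0 < s by [].
have st : s < t by near: s; exact: nbhs_right_lt.
have ts0 : 0 < t - s by rewrite subr_gt0.
have -> : t = s + (t - s) by rewrite addrC subrK.
rewrite (restricted_law s0 ts0 bf uf (Cc_right_ucont cf)).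
rewrite (restricted_law s0 ts0 bfk ufk (Cc_right_ucont cfk)).
have rs := rcs_radon mutP (ltW s0).
apply: integ_dist.
- exact: (integ_fiber_bcont hG rs bfk ufk cid).
- exact: (integ_fiber_bcont hG rs bf uf cid).
move=> h; have := h1 h; have := h2 h.
have -> : integ (mut s) (fun x => f (k * (x^-1 * h))%g) =
    integ (mut s) (fun x => f (x^-1 * h)%g).
  rewrite -(integ_right_invariant (rcs_right_invariant mutP s0)
    (subgroup_inv cK Kk) (bcont_mulVg h (Cc_bcont cf))).
  by congr integ; apply/funext => x; rewrite invgM invgK mulgA.
rewrite !ler_norml => /andP[? ?] /andP[? ?]; apply/andP; split; lra.
Unshelve. all: by end_near. Qed.

Lemma restricted_semigroup : convolution_semigroup mut.
Proof.
split=> [t|s t s0 t0 f cf]; first exact: rcs_radon mutP t.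
have uf := Cc_left_ucont cf; have bf := Cc_bdd cf; have bcf := Cc_bcont cf.
have [s00|s1] := eqVneq s 0.
  rewrite s00 add0r; congr integ; apply/funext => h.
  by rewrite (integ_dirac (bcont_mulr h bcf) (rcs_zero mutP)) mul1g.
have [t00|t1] := eqVneq t 0.
  rewrite t00 addr0 (integ_dirac _ (rcs_zero mutP)).
    by congr integ; apply/funext => g; rewrite mulg1.
  apply: (integ_fiber_bcont hG (rcs_radon mutP s0) bf uf (psi := id)).
  by move=> x; exact: cvg_id.
apply: restricted_law => //; last exact: Cc_right_ucont.
  by rewrite lt_neqAle eq_sym s1.
by rewrite lt_neqAle eq_sym t1.
Qed.

End Restricted.

(** * The normalised Haar measure of [K] as initial measure *)

Section InitialMeasure.
Variables (R : realType) (G : topologicalGroupType) (K : set G).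
Variable omega : probability (borel G) R.
Implicit Types (f F : G -> R) (mu : probability (borel G) R).
Hypothesis hG : hausdorff_space G.
Hypothesis cK : compact_subgroup K.
Hypothesis omegaP : normalized_haar_of K omega.

Let cid : continuous (id : G -> G).
Proof. by move=> x; exact: cvg_id. Qed.

Lemma integ_haar_const F (c : R) : bcont F -> (forall k, K k -> F k = c) ->
  integ omega F = c.
Proof.
move=> bF Fc; have mK := compact_borel hG (subgroup_compact cK).
have oK := normalized_haar_supp omegaP; have [cF [M hM]] := bF.
rewrite (integ_setC omega bF mK).
have -> : \int[omega]_(x in K) F x = c.
  transitivity (\int[omega]_(x in (K : set (borel G))) c).
    by apply: eq_Rintegral => x; rewrite inE => Kx; exact: Fc.
  by rewrite Rintegral_cst// [X in fine X]oK mulr1.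
have : `|\int[omega]_(x in ~` (K : set (borel G))) F x| <= M * 0.
  apply: le_trans (@normr_Rintegral_le _ _ omega F _ M bF _ _) _ => //.
    exact: measurableC.
  by rewrite probability_setC// [X in (_ - X)%E]oK subee.
by rewrite mulr0 normr_le0 => /eqP ->; rewrite addr0.
Qed.

Lemma haar_convolution mu f : left_invariant K mu -> bdd f -> left_ucont f ->
  integ mu (fun h => integ omega (fun g => f (g * h)%g)) = integ mu f.
Proof.
move=> imu bf uf; have ro := normalized_haar_radon omegaP.
rewrite -(integ_swap hG mu ro bf uf cid); apply: integ_haar_const.
  exact: integ_orbit_bcont.
by move=> k Kk; exact: (integ_left_invariant imu Kk (left_ucont_bcont bf uf)).
Qed.

Lemma convolution_haar mu f : radon mu -> right_invariant K mu -> bdd f ->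
  left_ucont f ->
  integ omega (fun h => integ mu (fun g => f (g * h)%g)) = integ mu f.
Proof.
move=> rmu imu bf uf; apply: integ_haar_const.
  exact: (integ_fiber_bcont hG rmu bf uf cid).
by move=> k Kk; exact: (integ_right_invariant imu Kk (left_ucont_bcont bf uf)).
Qed.

Definition haar_average f x := integ omega (fun y => f (x * y)%g).

Lemma haar_average_invariant f : bcont f ->
  right_invariant_fun K (haar_average f).
Proof.
move=> bf x k Kk; rewrite /haar_average.
rewrite -[RHS](integ_left_invariant (normalized_haar_invariant omegaP) Kk).
  by congr integ; apply/funext => y; rewrite mulgA.
exact: bcont_mull.
Qed.

Lemma haar_average_Cc f : Cc f -> Cc (haar_average f).
Proof.
move=> cf; apply: compact_supp_Cc.
  by have [] := integ_orbit_bcont omega (Cc_bdd cf) (Cc_left_ucont cf) cid.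
apply: (compact_supp_sub hG (compact_mulg cf.2 (subgroup_compact cK))) => x hx.
have [k Kk fxk] : exists2 k, K k & f (x * k)%g != 0.
  apply: contrapT => h; move/eqP : hx; apply; apply: integ_haar_const.
    exact: (bcont_mull x (Cc_bcont cf)).
  move=> k Kk; apply/eqP; apply: contrapT => /negP fk; apply: h.
  by exists k.
exists ((x * k)%g, (k^-1)%g); last by rewrite /= mulgK.
by split; [exact: supp_neq0|exact: subgroup_inv].
Qed.

Variable mut : R -> probability (borel G) R.
Hypothesis lG : locally_compact [set: G].
Hypothesis mutP : restricted_convolution_semigroup K mut.

Lemma restricted_cvg_haar f : Cc f ->
  integ (mut t) f @[t --> 0^'+] --> integ omega f.
Proof.
move=> cf; have uf := Cc_left_ucont cf; have bf := Cc_bdd cf.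
have := rcs_continuous mutP (haar_average_Cc cf)
  (haar_average_invariant (Cc_bcont cf)).
have -> : haar_average f 1%g = integ omega f.
  by rewrite /haar_average; congr integ; apply/funext => y; rewrite mul1g.
apply: cvg_trans; apply: near_eq_cvg; near=> t.
have t0 : 0 < t by [].
have rt := rcs_radon mutP (ltW t0).
rewrite /haar_average (integ_swap hG omega rt bf uf cid).
by rewrite convolution_haar//; exact: rcs_right_invariant mutP _ t0.
Unshelve. all: by end_near. Qed.

Lemma haar_right_invariant : right_invariant K omega.
Proof.
move=> A k mA Kk.
apply: (radon_invariant hG lG (phi := fun x => (x * k)%g)
  (psi := fun x => (x * k^-1)%g)) => //.
- exact: normalized_haar_radon omegaP.
- exact: continuous_mulgr.
- exact: continuous_mulgr.
- by move=> x; rewrite mulgK.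
- by move=> x; rewrite mulgVK.
move=> f cf; apply: (cvg_unique _ (restricted_cvg_haar (Cc_mulr hG k cf)) _).
  exact: norm_hausdorff.
apply: cvg_trans (restricted_cvg_haar cf); apply: near_eq_cvg; near=> t.
have t0 : 0 < t by [].
rewrite (integ_right_invariant (rcs_right_invariant mutP t0))//.
exact: Cc_bcont.
Unshelve. all: by end_near. Qed.

Lemma replace_at0_semigroup :
  continuous_bi_invariant_convolution_semigroup K (replace_at0 omega mut).
Proof.
have r0 : replace_at0 omega mut 0 = omega by rewrite /replace_at0 eqxx.
have rt (t : R) : 0 < t -> replace_at0 omega mut t = mut t.
  by move=> t0; rewrite /replace_at0 gt_eqF.
have cases (t : R) : 0 <= t -> t = 0 \/ 0 < t.
  by rewrite le_eqVlt => /orP[/eqP <-|]; [left|right].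
have bi (t : R) : 0 <= t -> bi_invariant K (replace_at0 omega mut t).
  move=> /cases[->|t0].
    rewrite r0; split; first exact: haar_right_invariant.
    exact: normalized_haar_invariant omegaP.
  rewrite rt//; split; first exact: rcs_right_invariant mutP _ t0.
  exact: (restricted_left_invariant hG lG cK mutP t0).
split=> //.
  split=> [t /cases[->|t0]|s t s0 t0 f cf].
  - by rewrite r0; exact: normalized_haar_radon omegaP.
  - by rewrite rt//; exact: rcs_radon mutP _ (ltW t0).
  have uf := Cc_left_ucont cf; have bf := Cc_bdd cf.
  have [s00|s1] := cases s s0.
    by rewrite s00 r0 add0r haar_convolution//; exact: (bi t t0).2.
  have [t00|t1] := cases t t0.
    rewrite t00 r0 addr0 rt// convolution_haar//; first exact: rcs_radon mutP _ s0.
    exact: rcs_right_invariant mutP _ s1.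
  rewrite !rt ?addr_gt0//; apply: (restricted_law hG lG cK mutP) => //.
  exact: Cc_right_ucont.
move=> f cf; rewrite r0; apply: cvg_trans (restricted_cvg_haar cf).
by apply: near_eq_cvg; near=> t; rewrite rt.
Unshelve. all: by end_near. Qed.

End InitialMeasure.

Theorem theorem3p1 (R : realType) (G : topologicalGroupType) (K : set G)
    (mut : R -> probability (borel G) R) :
  gelfand_pair R K ->
  restricted_convolution_semigroup K mut ->
  [/\ convolution_semigroup mut,
      (forall t : R, 0 < t -> bi_invariant K (mut t)) &
      forall omega : probability (borel G) R, normalized_haar_of K omega ->
        continuous_bi_invariant_convolution_semigroup K
          (replace_at0 omega mut)].
Proof.
move=> [lG hG cK _] mutP; split.
- exact: (restricted_semigroup hG lG cK mutP).
- move=> t t0; split; first exact: (rcs_right_invariant mutP t0).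
  exact: (restricted_left_invariant hG lG cK mutP t0).
- by move=> omega omegaP; exact: replace_at0_semigroup.
Qed.
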